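(* Let $\mathbb A$ be a finite idempotent algebra with universe $A$. Then $\mathbb A$ has the exponentially generated powers (EGP) property if and only if there exist $\alpha,\beta\subsetneq A$ with $\alpha\cup\beta=A$ such that every operation of $\mathbb A$ is $\alpha\beta$-projective.
   Context: A finite algebra $\mathbb A$ is a finite nonempty set $A$ together with a (possibly infinite) family of finitary operations on $A$. It is idempotent if every operation $f$ satisfies $f(x,x,\ldots,x)=x$ for all $x\in A$. The power $\mathbb A^{n}$ ($n\ge 1$) has universe $A^n$, with operations acting coordinatewise; it is generated by a set $X\subseteq A^n$ if the smallest subset of $A^n$ containing $X$ and closed under all (coordinatewise) operations is $A^n$. EGP: $\mathbb A$ has the exponentially generated powers (EGP) property if there exist real numbers $b>1$ and $C>0$ such that for every $n\ge 1$ the power $\mathbb A^{n}$ cannot be generated by less than $C b^{n}$ tuples. $\alpha\beta$-projective: let $\alpha,\beta\subsetneq A$ with $\alpha\cup\beta=A$. An operation $f\colon A^{n}\to A$ is $\alpha\beta$-projective if there exists $j\in\{1,2,\ldots,n\}$ such that for every $(a_1,\ldots,a_n)\in A^{n}$ and every $S\in\{\alpha,\beta\}$ we have $f(a_1,\ldots,a_{j-1},S,a_{j+1},\ldots,a_n)\subseteq S$, where the left-hand side denotes $\{f(a_1,\ldots,a_{j-1},s,a_{j+1},\ldots,a_n)\mid s\in S\}$. *)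

(* Defs.v *)
From mathcomp Require Import all_boot all_order all_algebra.
From mathcomp Require Import reals.

Set Implicit Arguments.
Unset Strict Implicit.
Unset Printing Implicit Defensive.

Import Order.TTheory GRing.Theory Num.Theory.
Local Open Scope ring_scope.

(* The family of operations is indexed by an arbitrary type, so it may be
   infinite; an n-tuple over A is a finite function 'I_n -> A. *)
Record finAlgebra := FinAlgebra {
  carrier :> finType;
  carrier_gt0 : (0 < #|carrier|)%N;
  opIndex : Type;
  arity : opIndex -> nat;
  oper : forall o : opIndex, {ffun 'I_(arity o) -> carrier} -> carrier
}.

Definition idempotent_op (A : finType) (n : nat)
    (f : {ffun 'I_n -> A} -> A) : Prop :=
  forall x : A, f [ffun => x] = x.

Definition idempotent_alg (A : finAlgebra) : Prop :=
  forall o : opIndex A, idempotent_op (@oper A o).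

Lemma power_gt0 (A : finAlgebra) (n : nat) :
  (0 < #|{: {ffun 'I_n -> A}}|)%N.
Proof. by rewrite card_ffun expn_gt0 carrier_gt0. Qed.

Definition power (A : finAlgebra) (n : nat) : finAlgebra :=
  @FinAlgebra {ffun 'I_n -> A} (power_gt0 A n) (opIndex A) (@arity A)
    (fun o (x : {ffun 'I_(arity o) -> {ffun 'I_n -> A}}) =>
       [ffun i => oper [ffun k => x k i]]).

Definition subuniverse (A : finAlgebra) (S : {set A}) : Prop :=
  forall (o : opIndex A) (x : {ffun 'I_(arity o) -> A}),
    (forall k, x k \in S) -> oper x \in S.

Definition smallest_subuniverse (A : finAlgebra) (X S : {set A}) : Prop :=
  [/\ X \subset S, subuniverse S &
      forall S' : {set A}, X \subset S' -> subuniverse S' -> S \subset S'].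

Definition generates (A : finAlgebra) (X : {set A}) : Prop :=
  smallest_subuniverse X [set: A].

Definition EGP (R : realType) (A : finAlgebra) : Prop :=
  exists b C : R, [/\ 1 < b, 0 < C &
    forall n : nat, (1 <= n)%N ->
      forall X : {set power A n}, #|X|%:R < C * b ^+ n -> ~ generates X].

Definition subst_coord (A : finType) (n : nat) (a : {ffun 'I_n -> A})
    (j : 'I_n) (s : A) : {ffun 'I_n -> A} :=
  [ffun k => if k == j then s else a k].

Definition projective (A : finType) (alpha beta : {set A}) (n : nat)
    (f : {ffun 'I_n -> A} -> A) : Prop :=
  exists j : 'I_n, forall (a : {ffun 'I_n -> A}) (S : {set A}),
    S \in [:: alpha; beta] ->
    [set f (subst_coord a j s) | s in S] \subset S.

(* Main.v *)
Require Import Defs.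
From mathcomp Require Import all_boot all_order all_algebra.
From mathcomp Require Import boolp reals ring.

Set Implicit Arguments.
Unset Strict Implicit.
Unset Printing Implicit Defensive.

Import Order.TTheory GRing.Theory Num.Theory.
Local Open Scope ring_scope.

(* If some alpha, beta work for all operations, put C = A \ alpha and
   D = A \ beta: to produce a tuple in a product of n factors C or D one already
   needs a tuple in the same product, and there are 2^n disjoint such products.

   Otherwise a composition u of operations, of arity M say, has for every
   position k an element e_k such that every value c of A is taken by u at some
   tuple with k-th entry e_k. Cutting a set of free coordinates into M equal
   blocks, any tuple is the value of u at M tuples, the k-th one being constantly
   e_k on the k-th block. After s rounds A^n is generated by M^s sets of tuples
   with only n (1 - 1/M)^s free coordinates, which is fewer than C b^n for s and
   then n large. *)

(** * Idempotent term operations and their composition *)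

(* Term operations, described by what they preserve so as to avoid syntax. *)
Definition term_op (A : finAlgebra) (I : finType) (f : {ffun I -> A} -> A) : Prop :=
  forall (n : nat) (S : {set power A n}), subuniverse S ->
  forall x : I -> {ffun 'I_n -> A}, (forall k, x k \in S) ->
    [ffun i => f [ffun k => x k i]] \in S.

Definition idem_term (A : finAlgebra) (I : finType) (f : {ffun I -> A} -> A) : Prop :=
  term_op f /\ forall x : A, f [ffun => x] = x.

(** Each copy of [g] gets its own variables, so the positions of the composite are pairs
    [(i, j)]. *)
Definition star (A I J : finType) (f : {ffun I -> A} -> A)
    (g : {ffun J -> A} -> A) (x : {ffun I * J -> A}) : A :=
  f [ffun i => g [ffun j => x (i, j)]].

Lemma idem_term_oper (A : finAlgebra) (o : opIndex A) :
  idempotent_alg A -> idem_term (@oper A o).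
Proof.
move=> idA; split=> [n S subS x xS|]; last exact: idA.
suff -> : [ffun i => oper [ffun k => x k i]] =
          @oper (power A n) o [ffun k => x k].
  by apply: subS => k; rewrite ffunE.
apply/ffunP => i; rewrite !ffunE; congr oper.
by apply/ffunP => k; rewrite !ffunE.
Qed.

Lemma idem_term_star (A : finAlgebra) (I J : finType)
    (f : {ffun I -> A} -> A) (g : {ffun J -> A} -> A) :
  idem_term f -> idem_term g -> idem_term (star f g).
Proof.
move=> [tf idf] [tg idg]; split=> [n S subS x xS|x].
  suff -> : [ffun l => star f g [ffun k => x k l]] =
      [ffun l => f [ffun i => [ffun l => g [ffun j => x (i, j) l]] l]].
    by apply: tf => // i; apply: tg.
  apply/ffunP => l; rewrite !ffunE /star; congr f.
  apply/ffunP => i; rewrite !ffunE; congr g.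
  by apply/ffunP => j; rewrite !ffunE.
rewrite /star -[RHS]idf; congr f; apply/ffunP => i; rewrite !ffunE -[RHS]idg.
by congr g; apply/ffunP => j; rewrite !ffunE.
Qed.

(** * Stable sets and projectivity *)

(* [coord_stable f k C] says that the complement of [C] is preserved by putting
   it in position [k]; so [f] is projective for [~: C] and [~: D] iff both [C]
   and [D] are stable for a common position. *)
Definition coord_stable (A I : finType) (f : {ffun I -> A} -> A) (k : I)
    (C : {set A}) : bool :=
  [forall a : {ffun I -> A}, (f a \in C) ==> (a k \in C)].

Lemma coord_stableP (A I : finType) (f : {ffun I -> A} -> A) k (C : {set A}) :
  reflect (forall a : {ffun I -> A}, f a \in C -> a k \in C)
          (coord_stable f k C).
Proof. by apply: (iffP forallP) => h a; have := h a; move/implyP. Qed.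

Lemma coord_stable_setT (A I : finType) (f : {ffun I -> A} -> A) k :
  coord_stable f k [set: A].
Proof. by apply/coord_stableP => a; rewrite !inE. Qed.

Lemma coord_stable_setI (A I : finType) (f : {ffun I -> A} -> A) k
    (C D : {set A}) :
  coord_stable f k C -> coord_stable f k D -> coord_stable f k (C :&: D).
Proof.
move=> /coord_stableP hC /coord_stableP hD; apply/coord_stableP => a.
by rewrite !inE => /andP[/hC -> /hD ->].
Qed.

Lemma projective_setC (A : finType) n (f : {ffun 'I_n -> A} -> A) k
    (C D : {set A}) :
  coord_stable f k C -> coord_stable f k D -> projective (~: C) (~: D) f.
Proof.
move=> /coord_stableP hC /coord_stableP hD; exists k => a S SCD.
apply/subsetP => _ /imsetP[s sS ->].
have E : subst_coord a k s k = s by rewrite ffunE eqxx.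
move: SCD sS; rewrite !inE => /orP[]/eqP ->; rewrite !inE; apply: contra.
  by move/hC; rewrite E.
by move/hD; rewrite E.
Qed.

(** Feeding one value to all variables of each copy of [g] turns the composite into [f], since [g]
    is idempotent. *)
Lemma coord_stable_starl (A I J : finType) (f : {ffun I -> A} -> A)
    (g : {ffun J -> A} -> A) i j (C : {set A}) :
  (forall x, g [ffun => x] = x) ->
  coord_stable (star f g) (i, j) C -> coord_stable f i C.
Proof.
move=> idg /coord_stableP h; apply/coord_stableP => a fa.
have := h [ffun p => a p.1]; rewrite ffunE /=; apply.
rewrite /star; congr (f _ \in C): fa; apply/ffunP => l; rewrite ffunE -[LHS]idg.
by congr g; apply/ffunP => m; rewrite !ffunE.
Qed.

(** Feeding the same tuple to all copies of [g] turns the composite into [g], since [f] is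
    idempotent. So a composite separates whatever one of its factors separates. *)
Lemma coord_stable_starr (A I J : finType) (f : {ffun I -> A} -> A)
    (g : {ffun J -> A} -> A) i j (C : {set A}) :
  (forall x, f [ffun => x] = x) ->
  coord_stable (star f g) (i, j) C -> coord_stable g j C.
Proof.
move=> idf /coord_stableP h; apply/coord_stableP => a ga.
have := h [ffun p => a p.2]; rewrite ffunE /=; apply.
rewrite /star; move: ga; rewrite -[g a]idf; congr (f _ \in C).
apply/ffunP => l; rewrite !ffunE; congr g.
by apply/ffunP => m; rewrite !ffunE.
Qed.

(** * One term separating all disjoint pairs *)

Definition separates (A I : finType) (f : {ffun I -> A} -> A) (C D : {set A}) :=
  forall k, ~~ (coord_stable f k C && coord_stable f k D).

(** Composing with an operation that separates one more pair keeps the earlier separations; a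
    projection starts the induction. *)
Lemma term_separating_seq (A : finAlgebra) (s : seq ({set A} * {set A})) :
  idempotent_alg A ->
  (forall C D : {set A}, C != set0 -> D != set0 -> [disjoint C & D] ->
     exists o : opIndex A, separates (@oper A o) C D) ->
  exists (I : finType) (f : {ffun I -> A} -> A), idem_term f /\
    forall C D, (C, D) \in s -> C != set0 -> D != set0 -> [disjoint C & D] ->
      separates f C D.
Proof.
move=> idA sepA; elim: s => [|[C D] s [I [f [tf sepf]]]].
  exists unit, (fun a => a tt); split=> //; split=> [n S _ x xS|x].
    have := xS tt; congr (_ \in S); apply/ffunP => i.
    by rewrite !ffunE.
  by rewrite ffunE.
have [/and3P[C0 D0 CD]|nCD] :=
    boolP [&& C != set0, D != set0 & [disjoint C & D]]; last first.
  exists I, f; split=> // C' D'; rewrite inE => /orP[/eqP[-> ->] C0 D0 CD|].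
    by rewrite C0 D0 CD in nCD.
  exact: sepf.
have [o sepo] := sepA C D C0 D0 CD.
have to := idem_term_oper o idA.
exists ('I_(arity o) * I)%type, (star (@oper A o) f); split.
  exact: idem_term_star.
move=> C' D'; rewrite inE => /orP[/eqP[-> ->] _ _ _|sCD C0' D0' CD'] [i j].
  apply: contra (sepo i) => /andP[hC hD].
  by rewrite (coord_stable_starl tf.2 hC) (coord_stable_starl tf.2 hD).
apply: contra (sepf _ _ sCD C0' D0' CD' j) => /andP[hC hD].
by rewrite (coord_stable_starr to.2 hC) (coord_stable_starr to.2 hD).
Qed.

Lemma term_separating (A : finAlgebra) :
  idempotent_alg A ->
  (forall C D : {set A}, C != set0 -> D != set0 -> [disjoint C & D] ->
     exists o : opIndex A, separates (@oper A o) C D) ->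
  exists (I : finType) (f : {ffun I -> A} -> A), idem_term f /\
    forall C D, C != set0 -> D != set0 -> [disjoint C & D] -> separates f C D.
Proof.
move=> idA sepA.
have [I [f [tf sepf]]] :=
  @term_separating_seq A (enum {: {set A} * {set A}}) idA sepA.
by exists I, f; split=> // C D; apply: sepf; rewrite mem_enum.
Qed.

(** * Synchronizing terms *)

(** An element common to these sets for all [c] can serve as [e_k]: fixing position [k] at it leaves
    [f] onto. *)
Definition coord_image (A I : finType) (f : {ffun I -> A} -> A) (k : I) (c : A) :
  {set A} := [set a k | a : {ffun I -> A} & f a == c].

Lemma coord_imageP (A I : finType) (f : {ffun I -> A} -> A) k c e :
  reflect (exists2 a : {ffun I -> A}, f a = c & a k = e)
          (e \in coord_image f k c).
Proof.
apply: (iffP imsetP) => [[a]|[a fa ak]].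
  by rewrite inE => /eqP fa ->; exists a.
by exists a; rewrite ?inE ?fa.
Qed.

Lemma mem_coord_image (A I : finType) (f : {ffun I -> A} -> A) k c :
  (forall x, f [ffun => x] = x) -> c \in coord_image f k c.
Proof. by move=> idf; apply/coord_imageP; exists [ffun => c]; rewrite ?ffunE. Qed.

(** Entry [i] of a solution for [f] is expanded by a solution for [g]; the other copies of [g] get
    constant tuples. *)
Lemma coord_image_star (A I J : finType) (f : {ffun I -> A} -> A)
    (g : {ffun J -> A} -> A) i j c d e :
  (forall x, g [ffun => x] = x) ->
  d \in coord_image f i c -> e \in coord_image g j d ->
  e \in coord_image (star f g) (i, j) c.
Proof.
move=> idg /coord_imageP[a fa ai] /coord_imageP[b gb bj].
apply/coord_imageP; exists [ffun p => if p.1 == i then b p.2 else a p.1].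
  rewrite -fa /star; congr f; apply/ffunP => l; rewrite !ffunE.
  have [->|li] := eqVneq l i.
    rewrite ai -gb; congr g; apply/ffunP => m.
    by rewrite !ffunE /= eqxx.
  rewrite -[RHS]idg; congr g; apply/ffunP => m.
  by rewrite !ffunE /= (negbTE li).
by rewrite ffunE /= eqxx.
Qed.

Lemma coord_image_stable (A I : finType) (f : {ffun I -> A} -> A) k (C : {set A}) :
  (forall c, c \in C -> coord_image f k c \subset C) -> coord_stable f k C.
Proof.
move=> h; apply/coord_stableP => a fa.
by apply: (subsetP (h _ fa)); apply/coord_imageP; exists a.
Qed.

(* Composing with a separating term enlarges some [coord_image f k c], unless
   all of them are stable, and then they have a common point because disjoint
   nonempty stable sets do not exist. *)
Lemma term_synchronizing_or_large (A : finAlgebra) (J : finType)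
    (w : {ffun J -> A} -> A) (N : nat) :
  idem_term w ->
  (forall C D, C != set0 -> D != set0 -> [disjoint C & D] -> separates w C D) ->
  exists (I : finType) (f : {ffun I -> A} -> A), idem_term f /\
    forall k, (exists e, forall c, e \in coord_image f k c) \/
              (N <= \sum_c #|coord_image f k c|)%N.
Proof.
move=> tw sepw; elim: N => [|N [I [f [tf IH]]]].
  by exists J, w; split=> // k; right.
exists (I * J)%type, (star f w); split; first exact: idem_term_star.
move=> [i j].
have sub c : coord_image f i c \subset coord_image (star f w) (i, j) c.
  apply/subsetP => e he.
  exact: (coord_image_star tw.2 he (mem_coord_image j e tw.2)).
have [[e he]|le_N] := IH i.
  by left; exists e => c; apply: (subsetP (sub c)).
have [allst|] := boolP [forall c, coord_stable w j (coord_image f i c)].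
  left.
  (* Nonemptiness and stability are carried together through the intersection: two nonempty sets
     stable at [j] must meet, and their meet is again stable. *)
  have /andP[/set0Pn[e he] _] :
      (\bigcap_c coord_image f i c != set0) &&
      coord_stable w j (\bigcap_c coord_image f i c).
    apply: (big_ind (fun C => (C != set0) && coord_stable w j C))
      => [|C D /andP[C0 hC] /andP[D0 hD]|c _].
    - rewrite coord_stable_setT andbT -card_gt0 cardsT.
      exact: carrier_gt0.
    - rewrite coord_stable_setI // andbT setI_eq0.
      apply/negP => CD; have := sepw C D C0 D0 CD j.
      by rewrite hC hD.
    - rewrite (forallP allst) andbT; apply/set0Pn; exists c.
      exact: (mem_coord_image i c tf.2).
  exists e => c; apply: (subsetP (sub c)).
  by move/bigcapP: he; apply.
rewrite negb_forall => /existsP[c nst]; right.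
apply: leq_ltn_trans le_N _.
rewrite (bigD1 c) //= [X in (_ < X)%N](bigD1 c) //= -addSn leq_add //.
  rewrite proper_card // properEneq sub andbT.
  (* An image that does not grow contains the images under [w] of its own elements, hence is
     stable. *)
  apply: contra nst => /eqP eqc; apply: coord_image_stable => d hd.
  apply/subsetP => e he; rewrite eqc.
  exact: (coord_image_star tw.2 hd he).
by apply: leq_sum => d _; apply: subset_leq_card.
Qed.

(** The images at one position have total size at most [#|A| * #|A|], so a larger bound leaves only
    the first alternative. *)
Lemma term_synchronizing (A : finAlgebra) (J : finType)
    (w : {ffun J -> A} -> A) :
  idem_term w ->
  (forall C D, C != set0 -> D != set0 -> [disjoint C & D] -> separates w C D) ->
  exists (I : finType) (f : {ffun I -> A} -> A), idem_term f /\
    forall k, exists e, forall c, e \in coord_image f k c.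
Proof.
move=> tw sepw.
have [I [f [tf h]]] :=
  @term_synchronizing_or_large A J w (#|A| * #|A|).+1 tw sepw.
exists I, f; split=> // k; have [//|] := h k.
rewrite leqNgt -leqNgt => le.
have : (\sum_c #|coord_image f k c| <= \sum_(c : A) #|A|)%N.
  by apply: leq_sum => c _; apply: max_card.
by rewrite sum_nat_const => /(leq_trans le); rewrite ltnn.
Qed.

(** Two dummy variables are added, at which any element works; the later count divides by the number
    of positions minus one. *)
Lemma term_synchronizing_card_gt1 (A : finAlgebra) (I : finType)
    (f : {ffun I -> A} -> A) :
  idem_term f -> (forall k, exists e, forall c, e \in coord_image f k c) ->
  exists (J : finType) (g : {ffun J -> A} -> A), [/\ (1 < #|J|)%N, idem_term g &
    forall k, exists e, forall c, e \in coord_image g k c].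
Proof.
move=> [tf idf] syncf.
pose g (x : {ffun I + bool -> A}) := f [ffun i => x (inl i)].
have [e0 _] : exists e : A, e \in A by apply/card_gt0P; exact: carrier_gt0.
exists (I + bool)%type, g; split.
- by rewrite card_sum card_bool addn2.
- split=> [n S subS x xS|x].
    suff -> : [ffun l => g [ffun k => x k l]] =
        [ffun l => f [ffun i => x (inl i) l]] by apply: tf.
    apply/ffunP => l; rewrite !ffunE /g; congr f.
    by apply/ffunP => i; rewrite !ffunE.
  by rewrite /g -[RHS]idf; congr f; apply/ffunP => i; rewrite !ffunE.
- case=> [i|b].
    have [e he] := syncf i; exists e => c.
    have /coord_imageP[a fa ai] := he c; apply/coord_imageP.
    exists [ffun k => if k is inl i then a i else e0]; last by rewrite ffunE.
    by rewrite /g -fa; congr f; apply/ffunP => j; rewrite !ffunE.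
  exists e0 => c; apply/coord_imageP.
  exists [ffun k => if k is inl i then c else e0]; last by rewrite ffunE.
  by rewrite /g -[RHS]idf; congr f; apply/ffunP => j; rewrite !ffunE.
Qed.

(** * Generating boxes by boxes with fewer free coordinates *)

(** A bijection from [I * 'I_l] onto [F] cuts it into blocks of size [l]. The complements are
    counted because they are the coordinates that stay free. *)
Lemma equal_coloring (T I : finType) (F : {set T}) (l : nat) :
  (0 < #|I|)%N -> #|F| = (#|I| * l)%N ->
  exists col : T -> I, forall k,
    #|[set i in F | col i != k]| = (#|I|.-1 * l)%N.
Proof.
move=> I0 cF; have /card_gt0P[k0 _] := I0.
have E : #|{: I * 'I_l}| = #|F| by rewrite cF card_prod card_ord.
pose g (y : I * 'I_l) := enum_val (cast_ord E (enum_rank y)).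
have g_inj : injective g.
  by move=> y z /enum_val_inj/cast_ord_inj/enum_rank_inj.
have gF : [set g y | y : I * 'I_l] = F.
  apply/eqP; rewrite eqEcard card_imset // E leqnn andbT.
  by apply/subsetP => _ /imsetP[y _ ->]; apply: enum_valP.
pose col i := odflt k0 (omap fst [pick y | g y == i]).
have colg y : col (g y) = y.1.
  rewrite /col; case: pickP => [z /eqP/g_inj -> //|/(_ y)].
  by rewrite eqxx.
exists col => k.
have -> : [set i in F | col i != k] = F :\: [set g (k, j) | j : 'I_l].
  apply/setP => i; rewrite !inE andbC; have [iF|] := boolP (i \in F);
    rewrite ?andbF // !andbT.
  move: iF; rewrite -gF => /imsetP[y _ ->]; rewrite colg; congr (~~ _).
  apply/eqP/imsetP => [<-|[j _ /g_inj -> //]].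
  by exists y.2; rewrite -?surjective_pairing.
rewrite cardsD (setIidPr _); last first.
  by rewrite -gF; apply/subsetP => _ /imsetP[j _ ->]; apply: imset_f.
rewrite card_imset; last by move=> j j' /g_inj[].
by rewrite card_ord cF -[X in (_ - X)%N]mul1n -mulnBl subn1.
Qed.

Definition box (A : finType) (n : nat) (F : {set 'I_n}) (v : {ffun 'I_n -> A}) :
  {set {ffun 'I_n -> A}} :=
  [set t : {ffun 'I_n -> A} | [forall (i | i \notin F), t i == v i]].

Lemma boxP (A : finType) (n : nat) (F : {set 'I_n}) (v t : {ffun 'I_n -> A}) :
  reflect (forall i, i \notin F -> t i = v i) (t \in box F v).
Proof.
rewrite inE; apply: (iffP forall_inP) => h i /h; first by move/eqP.
by move->.
Qed.

Lemma card_box (A : finType) (n : nat) (F : {set 'I_n}) (v : {ffun 'I_n -> A}) :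
  #|box F v| = (#|A| ^ #|F|)%N.
Proof.
pose P (i : 'I_n) : {pred A} := fun c => (i \in F) || (c == v i).
rewrite (eq_card (B := mem (family P))); last first.
  move=> t; apply/boxP/familyP => h i.
    rewrite unfold_in /P; case: (boolP (i \in F)) => //= /h ->.
    exact: eqxx.
  by move=> /negbTE iF; have := h i; rewrite unfold_in /P iF => /eqP.
rewrite card_family foldrE big_map big_enum /= (bigID (mem F)) /=.
rewrite [X in (_ * X)%N]big1 ?muln1 => [|i /negbTE iF]; last first.
  rewrite -(card1 (v i)); apply: eq_card => c.
  by rewrite unfold_in /P iF.
rewrite -prod_nat_const; apply: eq_bigr => i iF.
by apply: eq_card => c; rewrite unfold_in /P iF.
Qed.

(** Induction on the number [s] of rounds; the factor [#|I| ^ s] lets [F] be cut into equal blocks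
    in every round. *)
Lemma box_generators (A : finAlgebra) (I : finType) (u : {ffun I -> A} -> A)
    (n s r : nat) (F : {set 'I_n}) (v : {ffun 'I_n -> A}) :
  (0 < #|I|)%N -> idem_term u ->
  (forall k, exists e, forall c, e \in coord_image u k c) ->
  #|F| = (#|I| ^ s * r)%N ->
  exists2 X : {set power A n},
    (#|X| <= #|I| ^ s * #|A| ^ (#|I|.-1 ^ s * r))%N &
    forall S : {set power A n}, subuniverse S -> X \subset S -> box F v \subset S.
Proof.
move=> I0 [tu idu] /fin_all_exists[e he].
elim: s r F v => [|s IH] r F v cF.
  exists (box F v) => //.
  by rewrite card_box cF !expn0 !mul1n.
have [|col ccol] := @equal_coloring _ I F (#|I| ^ s * r) I0.
  by rewrite cF expnS mulnA.
pose F' k := [set i in F | col i != k].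
(* Only the values off [F' k] matter: [e k] on the [k]-th block and [v] outside [F]. *)
pose v' k := [ffun i => if i \in F then e k else v i].
have cF' k : #|F' k| = (#|I| ^ s * (#|I|.-1 * r))%N by rewrite ccol mulnCA.
have /fin_all_exists2[X cX genX] k := IH _ _ (v' k) (cF' k).
exists (\bigcup_k X k).
  rewrite expnS -mulnA -sum_nat_const expnSr -mulnA.
  apply: leq_trans (leq_sum _ (fun k _ => cX k)).
  apply: (big_ind2 (fun (B : {set power A n}) m => (#|B| <= m)%N)) => //.
    by rewrite cards0.
  move=> B m B' m' Bm Bm'; apply: leq_trans (leq_add Bm Bm').
  by rewrite cardsU leq_subr.
move=> S subS XS; apply/subsetP => t /boxP tv.
(* Each [t i] is solved for separately, prescribing only the entry at the colour of [i]; the [k]-th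
   entries of the solutions then form a tuple of the [k]-th box. *)
have /fin_all_exists2[a ua ae] i :
    exists2 a : {ffun I -> A}, u a = t i & a (col i) = e (col i).
  exact/coord_imageP/he.
pose x k : {ffun 'I_n -> A} := [ffun i => if i \in F then a i k else v i].
have -> : t = [ffun i => u [ffun k => x k i]].
  apply/ffunP => i; rewrite ffunE; have [iF|iF] := boolP (i \in F).
    rewrite -ua; congr u; apply/ffunP => k.
    by rewrite !ffunE iF.
  rewrite tv // -[LHS]idu; congr u; apply/ffunP => k.
  by rewrite !ffunE (negbTE iF).
apply: tu => // k; apply: (subsetP (genX k S subS _)).
  by apply: subset_trans XS; apply: bigcup_sup.
apply/boxP => i; rewrite inE !ffunE negb_and negbK.
by case: ifP => //= _ /eqP <-.
Qed.

(** * Exponential estimates *)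

Lemma exprn_unbounded (R : realType) (b y : R) : 1 < b -> exists k, y < b ^+ k.
Proof.
move=> b1; have b10 : 0 < b - 1 by rewrite subr_gt0.
have bernoulli k : 1 + (b - 1) * k%:R <= b ^+ k.
  elim: k => [|k IH]; first by rewrite mulr0 addr0.
  rewrite exprS; apply: le_trans (ler_wpM2l _ IH); last first.
    by rewrite (le_trans ler01) // ltW.
  rewrite -subr_ge0 -natr1.
  have -> : b * (1 + (b - 1) * k%:R) - (1 + (b - 1) * (k%:R + 1)) =
      (b - 1) ^+ 2 * k%:R by ring.
  by rewrite mulr_ge0 // sqr_ge0.
exists (Num.bound (`|y| / (b - 1))); apply: lt_le_trans (bernoulli _).
have := archi_boundP (divr_ge0 (normr_ge0 y) (ltW b10)).
rewrite ltr_pdivrMr // mulrC => lt; apply: le_lt_trans (ler_norm y) _.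
by apply: lt_trans lt _; rewrite ltrDr.
Qed.

(** With [2 * a < b ^ k] and [k * M.-1 ^ s <= M ^ s], the right side is at least
    [C * (2 * a) ^ (M.-1 ^ s * q)]; its powers of 2 absorb [M ^ s / C] for large [q]. *)
Lemma box_count_small (R : realType) (b C : R) (M a : nat) :
  1 < b -> 0 < C -> (1 < M)%N -> (0 < a)%N ->
  exists s q, (0 < q)%N /\
    (M ^ s * a ^ (M.-1 ^ s * q))%:R < C * b ^+ (M ^ s * q).
Proof.
move=> b1 C0 M1 a0; have M10 : (0 < M.-1)%N by rewrite -ltnS prednK // ltnW.
have b0 : 0 <= b by rewrite (le_trans ler01) // ltW.
have [k hk] := exprn_unbounded (2 * a)%:R b1.
have [s hs] : exists s, (k * M.-1 ^ s <= M ^ s)%N.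
  have [|s hs] := @exprn_unbounded R (M%:R / M.-1%:R) k%:R.
    by rewrite ltr_pdivlMr ?ltr0n // mul1r ltr_nat ltn_predL ltnW.
  exists s; rewrite -(ler_nat R) natrM !natrX -ler_pdivlMr ?exprn_gt0 ?ltr0n //.
  by rewrite -expr_div_n ltW.
have [q hq] := @exprn_unbounded R 2 ((M ^ s)%:R / C) (ltr1n R 2).
exists s, q.+1; split=> //; set d := (M.-1 ^ s)%N.
have d0 : (0 < d)%N by rewrite expn_gt0 M10.
have {hq} : (M ^ s)%:R < C * 2 ^+ (d * q.+1).
  rewrite -ltr_pdivrMl // mulrC; apply: lt_le_trans hq _.
  rewrite ler_eXn2l ?ltr1n //; apply: leq_trans (leqnSn q) _.
  exact: leq_pmull.
rewrite natrM -(ltr_pM2r (x := (a ^ (d * q.+1))%:R)) ?ltr0n ?expn_gt0 ?a0 //.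
move=> lt; apply: lt_le_trans lt _.
rewrite -mulrA ler_pM2l // natrX -exprMn -natrM.
apply: (@le_trans _ _ ((b ^+ k) ^+ (d * q.+1))).
  by rewrite lerXn2r ?nnegrE ?exprn_ge0 // ltW.
by rewrite -exprM ler_eXn2l // mulnA leq_mul2r.
Qed.

(** * Exponential lower bound from projectivity *)

Lemma projective_coord_stable (A : finType) (al be : {set A}) n
    (f : {ffun 'I_n -> A} -> A) :
  projective al be f ->
  exists k, coord_stable f k (~: al) /\ coord_stable f k (~: be).
Proof.
move=> [k hk]; exists k.
have st S : S \in [:: al; be] -> coord_stable f k (~: S).
  move=> hS; apply/coord_stableP => a; rewrite !inE; apply: contra => akS.
  apply: (subsetP (hk a S hS)); apply/imsetP; exists (a k) => //.
  by congr f; apply/ffunP => j; rewrite ffunE; case: eqP => [->|].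
by split; apply: st; rewrite !inE eqxx ?orbT.
Qed.

(* Every product of [n] factors among [C] and [D] meets the generating set. *)
Lemma generators_ge_exp (A : finAlgebra) (C D : {set A}) (n : nat)
    (X : {set power A n}) :
  C != set0 -> D != set0 -> [disjoint C & D] ->
  (forall o : opIndex A, exists k,
     coord_stable (@oper A o) k C /\ coord_stable (@oper A o) k D) ->
  generates X -> (2 ^ n <= #|X|)%N.
Proof.
move=> /set0Pn[c cC] /set0Pn[d dD] CD stCD [_ _ minX].
pose side (g : {ffun 'I_n -> bool}) i := if g i then C else D.
pose inside g (t : {ffun 'I_n -> A}) := [forall i, t i \in side g i].
pose S : {set power A n} :=
  [set t | [forall g, inside g t ==> [exists x in X, inside g x]]].
have subS : subuniverse S.
  move=> o x xS; rewrite inE; apply/forallP => g; apply/implyP => /forallP gx.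
  (* As [k] serves both [C] and [D], the single argument [x k] lies in the whole product. *)
  have [k [/coord_stableP kC /coord_stableP kD]] := stCD o.
  have := xS k; rewrite inE => /forallP/(_ g)/implyP; apply.
  apply/forallP => i; have := gx i; rewrite ffunE /side.
  by case: (g i) => [/kC|/kD]; rewrite ffunE.
have XS : X \subset S.
  apply/subsetP => x xX; rewrite inE; apply/forallP => g; apply/implyP => gx.
  by apply/existsP; exists x; rewrite xX.
have /fin_all_exists2[x xX gx] (g : {ffun 'I_n -> bool}) :
    exists2 x : {ffun 'I_n -> A}, x \in X & inside g x.
  pose t : {ffun 'I_n -> A} := [ffun i => if g i then c else d].
  have := subsetP (minX S XS subS) t (in_setT _).
  rewrite inE => /forallP/(_ g)/implyP h; apply/exists_inP; apply: h.
  by apply/forallP => i; rewrite ffunE /side; case: (g i).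
have x_inj : injective x.
  move=> g h xgh; apply/ffunP => i.
  have := forallP (gx g) i; have := forallP (gx h) i; rewrite xgh /side.
  case: (g i); case: (h i) => // hD hC.
    by rewrite (disjointFr CD hC) in hD.
  by rewrite (disjointFr CD hD) in hC.
have := card_imset [set: {ffun 'I_n -> bool}] x_inj.
rewrite cardsT card_ffun card_bool card_ord => <-.
by apply/subset_leq_card/subsetP => _ /imsetP[g _ ->].
Qed.

(** * Equivalence of exponential generation and projectivity *)

Theorem theorem2 (R : realType) (A : finAlgebra) (hA : idempotent_alg A) :
  EGP R A <->
  exists alpha beta : {set A},
    [/\ alpha \proper [set: A], beta \proper [set: A],
        alpha :|: beta = [set: A] &
        forall o : opIndex A, projective alpha beta (@oper A o)].
Proof.
have setC_proper (S : {set A}) : (S \proper [set: A]) = (~: S != set0).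
  by rewrite properT -setCT (inj_eq (@setC_inj _)).
split=> [[b [C [b1 C0 egp]]]|[al [be [al1 be1 alU proj]]]]; last first.
  exists 2, 1; rewrite ltr1n ltr01; split=> // n _ X ltX genX.
  move: ltX; rewrite mul1r -natrX ltr_nat ltnNge.
  rewrite (@generators_ge_exp _ (~: al) (~: be)) -?setC_proper //.
    by rewrite -setI_eq0 -setCU alU setCT.
  by move=> o; apply: projective_coord_stable.
apply: contrapT => nproj.
(* If no operation separated this pair, the complements would serve as [alpha] and [beta]. *)
have sepA (E D : {set A}) : E != set0 -> D != set0 -> [disjoint E & D] ->
    exists o : opIndex A, separates (@oper A o) E D.
  move=> E0 D0 ED; apply: contrapT => nsep; apply: nproj.
  exists (~: E), (~: D); rewrite !setC_proper !setCK; split=> //.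
    by rewrite -setCI (disjoint_setI0 ED) setC0.
  move=> o; apply: contrapT => no; apply: nsep; exists o => k.
  by apply/negP => /andP[kE kD]; apply: no; apply: projective_setC kE kD.
have [J [w [tw sepw]]] := term_separating hA sepA.
have [I0 [f [tf syncf]]] := term_synchronizing tw sepw.
have [I [u [I1 tu syncu]]] := term_synchronizing_card_gt1 tf syncf.
have [s [q [q0 small]]] := box_count_small b1 C0 I1 (carrier_gt0 A).
have /card_gt0P[c0 _] := carrier_gt0 A.
(* With every coordinate free the box is the whole power, so the base tuple is arbitrary. *)
have [||X cX genX] := @box_generators A I u (#|I| ^ s * q) s q
  [set: 'I_(#|I| ^ s * q)] [ffun => c0] _ tu syncu _; rewrite ?(ltnW I1) //.
  by rewrite cardsT card_ord.
apply: (egp (#|I| ^ s * q)%N _ X).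
- by rewrite muln_gt0 expn_gt0 (ltnW I1).
- by apply: le_lt_trans small; rewrite ler_nat.
split=> [|o x _|S XS subS]; first exact: subsetT.
  by rewrite inE.
apply: subset_trans (genX S subS XS).
by apply/subsetP => t _; apply/boxP => i; rewrite inE.
Qed.
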